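(* For every integer $n\ge 1$, the cover pebbling number of the path $P_n$ on $n$ vertices is $\gamma(P_n)=2^n-1$.
   Context: All graphs are finite and connected. $P_n$ is the path with vertices $v_1,\ldots,v_n$ and edges $v_iv_{i+1}$ for $1\le i<n$. A configuration of pebbles on a graph $G$ assigns a nonnegative integer number of pebbles to each vertex; its size is the total number of pebbles. A pebbling move consists of taking two pebbles off of one vertex (which must have at least two) and placing one pebble on an adjacent vertex. The cover pebbling number $\gamma(G)$ is the minimum number $k$ such that from every initial configuration with $k$ pebbles there is a (possibly empty) sequence of pebbling moves after which every vertex of $G$ simultaneously has at least one pebble on it. *)

(* Defs.v *)
From mathcomp Require Import all_boot.

Set Implicit Arguments.
Unset Strict Implicit.
Unset Printing Implicit Defensive.

Record graph := Graph {
  vertex :> finType;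
  adj : rel vertex;
  adj_sym : symmetric adj;
  adj_irr : irreflexive adj;
  adj_connected : forall x y : vertex, connect adj x y
}.

Definition config (G : graph) := {ffun G -> nat}.

Definition config_size (G : graph) (c : config G) : nat := \sum_(v : G) c v.

(* The truncated subtraction is exact because of the guard [2 <= c u], and
   [u != v] by irreflexivity of [adj]. *)
Definition move (G : graph) (u v : G) (c : config G) : config G :=
  [ffun w => c w - 2 * (w == u) + (w == v)].

Definition pebbling_move (G : graph) : rel (config G) :=
  fun c c' => [exists u : G, exists v : G,
    [&& adj u v, 2 <= c u & c' == move u v c]].

Definition covered (G : graph) (c : config G) : Prop :=
  forall v : G, 0 < c v.

Definition coverable (G : graph) (c : config G) : Prop :=
  exists s : seq (config G),
    path (@pebbling_move G) c s /\ covered (last c s).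

Definition suffices_to_cover (G : graph) (k : nat) : Prop :=
  forall c : config G, config_size c = k -> coverable c.

(* [k] is the cover pebbling number of [G]: the minimum is expressed
   relationally, so that the predicate includes its existence. *)
Definition is_cover_pebbling_number (G : graph) (k : nat) : Prop :=
  suffices_to_cover G k /\
  (forall m : nat, suffices_to_cover G m -> k <= m).

(* [i : 'I_n] stands for the vertex v_(i+1). *)
Definition path_adj (n : nat) : rel 'I_n :=
  fun i j => (i.+1 == j :> nat) || (j.+1 == i :> nat).

Lemma path_adj_sym (n : nat) : symmetric (@path_adj n).
Proof. by move=> i j; rewrite /path_adj orbC. Qed.

Lemma path_adj_irr (n : nat) : irreflexive (@path_adj n).
Proof. by move=> i; rewrite /path_adj orbb gtn_eqF. Qed.

Lemma path_adj_connected (n : nat) (x y : 'I_n) : connect (@path_adj n) x y.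
Proof.
have up (d : nat) (i j : 'I_n) : j = i + d :> nat -> connect (@path_adj n) i j.
  elim: d j => [|d IHd] j Ej.
    by rewrite (_ : j = i) ?connect0 //; apply: val_inj; rewrite /= Ej addn0.
  have lt_n : i + d < n by rewrite (leq_trans _ (ltn_ord j)) // Ej addnS ltnS.
  apply: connect_trans (IHd (Ordinal lt_n) erefl) (connect1 _).
  by rewrite /path_adj /= Ej addnS eqxx.
case/orP: (leq_total x y) => le_xy.
  by apply: (up (y - x)); rewrite subnKC.
rewrite (sym_connect_sym (@path_adj_sym n)).
by apply: (up (x - y)); rewrite subnKC.
Qed.

Definition path_graph (n : nat) : graph :=
  Graph (@path_adj_sym n) (@path_adj_irr n) (@path_adj_connected n).

(* Main.v *)
(** Lower bound: give a pebble on v_i the weight 2^(i-1).  No move increases the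
    total weight, m pebbles stacked on v_1 weigh m, and a configuration covering
    the path weighs at least 1 + 2 + ... + 2^(n-1) = 2^n - 1.

    Upper bound: strengthen the claim so that it can be proved by induction on
    the length l of the path.  For every demand d >= 1, any 2^(l-1) (d + 1) - 1
    pebbles can be moved so as to cover the path with at least d pebbles on its
    first vertex.  Let that vertex hold a pebbles.  If a >= d, push as many pairs
    of the surplus a - d as possible to the second vertex and use induction with
    demand 1; if a < d, use induction on the rest with demand 1 + 2 (d - a) and
    then pull d - a pebbles back. *)

Require Import Defs.
From mathcomp Require Import all_boot.
From mathcomp Require Import zify.

Definition reachable (G : graph) (c c' : config G) : Prop :=
  exists2 s : seq (config G), path (@pebbling_move G) c s & last c s = c'.

Lemma reachable_refl (G : graph) (c : config G) : reachable G c c.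
Proof. by exists [::]. Qed.

Lemma reachable_trans (G : graph) (c1 c2 c3 : config G) :
  reachable G c1 c2 -> reachable G c2 c3 -> reachable G c1 c3.
Proof.
move=> [s1 p1 e1] [s2 p2 e2]; exists (s1 ++ s2); first by rewrite cat_path p1 e1.
by rewrite last_cat e1.
Qed.

Definition moves (G : graph) (t : nat) (u v : G) (c : config G) : config G :=
  [ffun w => c w - 2 * t * (w == u) + t * (w == v)].

Lemma reachable_moves (G : graph) (t : nat) (u v : G) (c : config G) :
  adj u v -> 2 * t <= c u -> reachable G c (moves G t u v c).
Proof.
move=> uv; have neq_uv : u != v by apply: contraTneq uv => ->; rewrite adj_irr.
elim: t => [|t IHt] le_cu.
  suff -> : moves G 0 u v c = c by exact: reachable_refl.
  by apply/ffunP => w; rewrite ffunE; lia.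
apply: (@reachable_trans _ _ (moves G t u v c)); first by apply: IHt; lia.
exists [:: moves G t.+1 u v c] => //=; rewrite andbT.
apply/existsP; exists u; apply/existsP; exists v.
rewrite uv /= ffunE eqxx (negPf neq_uv); apply/andP; split; first by lia.
apply/eqP/ffunP => w; rewrite !ffunE.
case: (eqVneq w u) => [->|_] /=; first by rewrite (negPf neq_uv); lia.
by case: (w == v) => /=; lia.
Qed.

Definition weight (n : nat) (c : config (path_graph n)) : nat :=
  \sum_(i < n) c i * 2 ^ i.

Lemma weight_move (n : nat) (u v : path_graph n) (c : config (path_graph n)) :
  adj u v -> 2 <= c u -> weight n (move u v c) <= weight n c.
Proof.
move=> uv c_u.
have {}c_u : 2 <= (c : {ffun 'I_n -> nat}) u by [].
have sum_eq (z : 'I_n) : \sum_(i < n) (i == z) * 2 ^ i = 2 ^ z.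
  rewrite (bigD1 z) //= eqxx mul1n big1 ?addn0 // => i /negPf ->.
  by rewrite mul0n.
(* Both sides are sums, so no truncated subtraction occurs; since [v <= u + 1], the gain [2 ^ v] is
   at most the loss. *)
have E : weight n (move u v c) + 2 * 2 ^ u = weight n c + 2 ^ v.
  rewrite -!sum_eq big_distrr -!big_split; apply: eq_bigr => i _ /=.
  rewrite ffunE; set b := i == v.
  by case: (eqVneq i u) => [->|_] /=; case: b => /=; nia.
have le_vu : 2 ^ v <= 2 * 2 ^ u.
  by rewrite -expnS leq_exp2l //; move: uv => /=; rewrite /path_adj; lia.
lia.
Qed.

Lemma weight_path (n : nat) (c : config (path_graph n)) s :
  path (@pebbling_move (path_graph n)) c s -> weight n (last c s) <= weight n c.
Proof.
elim: s c => //= c' s IHs c /andP [/existsP [u /existsP [v]]].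
move=> /and3P [uv c_u /eqP ->] /IHs le_w.
exact: leq_trans le_w (weight_move _ _ _ _ uv c_u).
Qed.

Lemma weight_covered (n : nat) (c : config (path_graph n)) :
  covered c -> 2 ^ n - 1 <= weight n c.
Proof.
move=> cov; rewrite subn1 predn_exp mul1n; apply: leq_sum => i _.
by rewrite leq_pmull //; apply: cov.
Qed.

(* Typing [c] on ['I_n] rather than on the convertible vertex type matters:
   [lia] would treat [c i] at the two types as distinct atoms. *)
Lemma reachable_moves_path (n t : nat) (u v : 'I_n) (c : {ffun 'I_n -> nat}) :
  path_adj u v -> 2 * t <= c u ->
  exists2 c' : {ffun 'I_n -> nat}, reachable (path_graph n) c c' &
    forall i, c' i = c i - 2 * t * (i == u) + t * (i == v).
Proof.
move=> uv le_cu; exists (moves (path_graph n) t u v c).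
  exact: reachable_moves.
by move=> i; rewrite ffunE.
Qed.

(** The clause on [i < k] carries the induction: applied at the next vertex, it leaves the pile on
    [k] intact. *)
Lemma cover_suffix (n m : nat) (k : 'I_n) (d : nat) (c : {ffun 'I_n -> nat}) :
  k.+1 + m = n -> 0 < d ->
  2 ^ m * d.+1 <= (\sum_(i < n | k <= i) c i).+1 ->
  exists2 c' : {ffun 'I_n -> nat}, reachable (path_graph n) c c' &
    [/\ forall i : 'I_n, i < k -> c' i = c i, d <= c' k &
        forall i : 'I_n, k < i -> 0 < c' i].
Proof.
elim: m k d c => [|m IHm] k d c Ekm d_gt0.
  rewrite (bigD1 k) //= big1 => [le_d|i]; last first.
    by move/andP => [le_ki]; rewrite -val_eqE /=; have := ltn_ord i; lia.
  exists c; first exact: reachable_refl.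
  by split=> // [|i]; [lia | have := ltn_ord i; lia].
have lt_k'n : k.+1 < n by lia.
pose k' := Ordinal lt_k'n.
have kk' : path_adj k k' by rewrite /path_adj eqxx.
have k'k : path_adj k' k by rewrite path_adj_sym.
have neq_k'k : (k' == k) = false by rewrite -val_eqE /=; lia.
have eq_k (i : 'I_n) : (i == k) = (i == k :> nat) by [].
have eq_k' (i : 'I_n) : (i == k') = (i == k.+1 :> nat) by [].
have sum_k : \sum_(i < n | k <= i) c i = c k + \sum_(i < n | k' <= i) c i.
  rewrite (bigD1 k) //=; congr (_ + _); apply: eq_bigl => i.
  by rewrite eq_k; lia.
rewrite {}sum_k expnS; set S := \sum_(i < n | k' <= i) c i => le_S.
have P_gt0 : 0 < 2 ^ m by rewrite expn_gt0.
have Ek'm : k'.+1 + m = n by rewrite /=; lia.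
case: (leqP d (c k)) => [le_d|lt_d].
  pose t := (c k - d)./2.
  have [|c1 r1 c1E] := reachable_moves_path n t k k' c kk'; first by lia.
  have sum_c1 : \sum_(i < n | k' <= i) c1 i = S + t.
    rewrite /S (bigD1 k') //= [in RHS](bigD1 k') //= c1E neq_k'k eqxx.
    rewrite (eq_bigr c) => [|i]; first by rewrite muln0 subn0 muln1 addnAC.
    by rewrite c1E eq_k eq_k' => le_i; nia.
  have [|c2 r2 [lo at_k' hi]] := IHm k' 1 c1 Ek'm isT.
    (* If [t >= 2 * 2 ^ m - 1], the pushed pebbles suffice alone. Otherwise [t] plus the parity bit
       of the surplus is at most [2 * 2 ^ m - 1], hence at most [d * (2 * 2 ^ m - 1)], which is what
       [le_S] requires. *)
    by rewrite sum_c1 /t; nia.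
  exists c2; first exact: reachable_trans r1 r2.
  split=> [i lt_ik||i lt_ki].
  - by rewrite lo /= ?c1E ?eq_k ?eq_k'; nia.
  - by rewrite lo //= c1E eqxx (eq_sym k) neq_k'k; lia.
  - have [-> //|] := eqVneq i k'; rewrite eq_k' => ne_ik'.
    by apply: hi => /=; lia.
pose t := d - c k.
have [||c1 r1 [lo at_k' hi]] := IHm k' (1 + 2 * t) c Ek'm; first by lia.
  (* As [c k = d - t], [le_S] exceeds the need by [(2 * 2 ^ m - 1) * (d - t)]. *)
  by rewrite -/S /t; nia.
have [|c2 r2 c2E] := reachable_moves_path n t k' k c1 k'k; first by lia.
exists c2; first exact: reachable_trans r1 r2.
split=> [i lt_ik||i lt_ki].
- by rewrite -lo /= ?c2E ?eq_k ?eq_k'; nia.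
- by rewrite c2E eqxx (eq_sym k) neq_k'k lo //= /t; lia.
- rewrite c2E; have [->|] := eqVneq i k'; first by lia.
  rewrite eq_k' => ne_ik'; have: 0 < c1 i by apply: hi => /=; lia.
  by lia.
Qed.

Theorem theorem3 (n : nat) (hn : 1 <= n) :
  is_cover_pebbling_number (path_graph n) (2 ^ n - 1).
Proof.
case: n hn => // n _; split=> [c size_c|m cov_m].
  (* Demand 1 on the whole path asks for [2 ^ n * 2 - 1] pebbles, exactly the given size. *)
  have [|//||c' [s path_s <-] [_ at0 hi]] := cover_suffix n.+1 n ord0 1 c.
  - by rewrite add1n.
  - have -> : \sum_(i < n.+1 | @ord0 n <= i) c i = config_size c by [].
    by rewrite size_c expnS; lia.
  exists s; split=> // i; case: (posnP i) => [i0|/hi //].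
  by rewrite (_ : i = ord0) //; apply: val_inj.
pose c : config (path_graph n.+1) := [ffun i : 'I_n.+1 => m * (i == ord0)].
have c_ord0 : c (@ord0 n) = m by rewrite ffunE eqxx muln1.
have c_neq0 (i : 'I_n.+1) : i != ord0 -> c i = 0.
  by move=> /negPf ne; rewrite ffunE ne muln0.
have size_c : config_size c = m.
  by rewrite /config_size (bigD1 (@ord0 n)) //= c_ord0 big1 ?addn0.
have weight_c : weight n.+1 c = m.
  rewrite /weight (bigD1 (@ord0 n)) //= c_ord0 big1 ?addn0 ?muln1 // => i.
  by move=> /c_neq0 ->.
have [s [path_s cov_s]] := cov_m c size_c.
rewrite -weight_c.
exact: leq_trans (weight_covered _ _ cov_s) (weight_path _ _ _ path_s).
Qed.
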